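(* Let $Y=(Y_1,\dots,Y_m)$ be a random vector with standard exponential marginals, and assume that for every $x\in\mathbb{R}^m$ the following two expressions coincide, so that $I(x)$ is well defined by $$I(x):=-\inf_{\varepsilon>0}\liminf_{y\to\infty}\frac1y\log P(Y/y\in B_\varepsilon(x))=-\inf_{\varepsilon>0}\limsup_{y\to\infty}\frac1y\log P(Y/y\in B_\varepsilon(x)).$$ Then for every Borel set $A\subset[0,\infty)^m$, $$-\inf I(A^{o})\le\liminf_{y\to\infty}\frac1y\log P(Y/y\in A)\le\limsup_{y\to\infty}\frac1y\log P(Y/y\in A)\le-\inf I(\bar A),$$ and $I$ is a good rate function satisfying $I(x\lambda)=\lambda I(x)$ for all $\lambda>0$ and $x\in\mathbb{R}^m$, $I(0)=0$, and $$\inf_{x\in\mathbb{R}^m:\ x_j>\lambda}I(x)=\lambda\qquad\forall\lambda\ge0,\ j\in\{1,\dots,m\}.$$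
   Context: $B_\varepsilon(x):=\{x'\in\mathbb{R}^m:\ \|x-x'\|_\infty<\varepsilon\}$. For a function $I$ with values in $[0,\infty]$ and a set $S$, $\inf I(S):=\inf_{x\in S}I(x)$ with $\inf\emptyset:=\infty$; $\log 0:=-\infty$. A rate function is a lower semicontinuous function with values in $[0,\infty]$; it is good if $I^{-1}([0,a])$ is compact for every $a\in[0,\infty)$. The displayed bounds are a large deviation principle on the topological space $[0,\infty)^m$: $A^o$ and $\bar A$ denote the interior and closure of $A$ in $[0,\infty)^m$. (Note that $I(x)=\infty$ whenever $\min_j x_j<0$.) *)

(* Defs.v *)
From HB Require Import structures.
From mathcomp Require Export all_boot all_order all_algebra.
From mathcomp Require Export all_classical all_reals all_analysis.
Export numFieldNormedType.Exports.

Set Implicit Arguments.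
Unset Strict Implicit.
Unset Printing Implicit Defensive.

Import Order.TTheory GRing.Theory Num.Theory.

Local Open Scope classical_set_scope.
Local Open Scope ring_scope.
Local Open Scope ereal_scope.

Section RateFunctions.
Context {R : realType} {X : topologicalType}.
Implicit Types I : X -> \bar R.

Definition rate_function I := (forall x, 0 <= I x) /\ lower_semicontinuous I.

Definition good_rate_function I :=
  rate_function I /\
  forall a : R, (0 <= a)%R -> compact (I @^-1` `[0, a%:E]).

End RateFunctions.

(* +oo when S is empty *)
Definition inf_over {R : realType} {X : Type} (I : X -> \bar R) (S : set X) :
  \bar R := ereal_inf (I @` S).

Section RowVectors.
Context {R : realType} {m : nat}.

Definition borel (A : set 'rV[R]_m) : Prop := <<s @open 'rV[R]_m >> A.

Definition orthant : set 'rV[R]_m := [set x | forall j, (0 <= x ord0 j)%R].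

(* Topology of [0, oo[^m.  In subspace orthant the points outside the orthant
   are isolated, so for A `<=` orthant both sets below stay inside the
   orthant. *)
Definition orthant_interior (A : set 'rV[R]_m) : set 'rV[R]_m :=
  interior (A : set (subspace orthant)).

Definition orthant_closure (A : set 'rV[R]_m) : set 'rV[R]_m :=
  closure (A : set (subspace orthant)).

End RowVectors.

Section RandomVectors.
Context {d : measure_display} {T : measurableType d} {R : realType}.
Variables (P : probability T R) (m : nat) (Y : 'I_m -> {RV P >-> R}).

Definition standard_exponential (Z : {RV P >-> R}) :=
  forall B : set R, measurable B -> distribution P Z B = exponential_prob 1 B.

(* y^-1 * log P(Y / y \in A), with log 0 = -oo *)
Definition scaled_log_prob (A : set 'rV[R]_m) (y : R) : \bar R :=
  (y^-1)%:E * lne (P [set w | A (y^-1 *: \row_j Y j w)%R]).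

Definition liminf_log_prob (A : set 'rV[R]_m) : \bar R :=
  limf_einf (scaled_log_prob A) (pinfty_nbhs R).

Definition limsup_log_prob (A : set 'rV[R]_m) : \bar R :=
  limf_esup (scaled_log_prob A) (pinfty_nbhs R).

(* The library norm on matrices is the maximum of the entries' norms, so
   ball x e is the open sup-norm ball. *)
Definition lower_local_rate (x : 'rV[R]_m) : \bar R :=
  - ereal_inf [set liminf_log_prob (ball x e) | e in [set e : R | (0 < e)%R]].

Definition upper_local_rate (x : 'rV[R]_m) : \bar R :=
  - ereal_inf [set limsup_log_prob (ball x e) | e in [set e : R | (0 < e)%R]].

End RandomVectors.

(* Main.v *)
Require Import Defs.
From mathcomp Require Import ring lra measurable_realfun.

(** Write [Y / y] for the rescaled vector.  Everything reduces to one notion: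
    a set [S] decays at rate [s] when [P (Y / y \in S) <= C * exp (- s * y)]
    for some constant [C] and all large [y].  At the exponential scale the
    constant is invisible, so decay at rate [s] gives
    [limsup y^-1 log P (Y / y \in S) <= - s] ([limsup_le_decays]), a strict
    inequality gives decay back ([decays_limsup_lt]), and for a fixed [s] the
    decaying sets are stable under subsets and finite unions
    ([decays_bigcup_finite]).  In these terms [I x > s] says that some ball
    around [x] decays at rate [s], up to the boundary case of equality
    ([upper_local_rate_ge], [upper_local_rate_gt]).

    The exponential marginals control the sets that finitely many balls cannot
    cover: [{x | x_j < 0}] is null, and for [t > 0] the tail [{x | x_j > t}] has
    probability exactly [exp (- t * y)], hence decays at rate [t].  This is
    exponential tightness.
    For the upper bound, if [I > s] on the closure of [A], then [A] is covered
    by negative half-spaces, the tails [{x | x_j > s}] and, by compactness of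
    the remaining part of the closure, finitely many balls decaying at rate [s];
    so [A] itself decays at rate [s] ([decays_of_rate_gt]).  For the lower
    bound, a point of the interior of [A] has a ball whose part in the orthant
    lies in [A], and the orthant carries all the mass; here the local rate
    enters through its liminf form.

    The properties of [I] come from the same calculus.  Balls around nearby
    points sit inside a given ball (lower semicontinuity); tails and negative
    half-spaces bound [I] from below and confine its sublevel sets to a compact
    box (goodness); substituting [l * y] for [y] turns decay of [S] at rate [s]
    into decay of [l S] at rate [l * s] (homogeneity).  Conversely, a set whose
    probability is at least [exp (- t * y)] cannot decay at a rate above [t]
    ([decays_rate_le]): applied to the whole space it forces [I 0 = 0], and
    applied to the tails it gives the infimum of [I] over a half-space. *)

Set Implicit Arguments.
Unset Strict Implicit.
Unset Printing Implicit Defensive.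

Import Order.TTheory GRing.Theory Num.Theory.

Local Open Scope classical_set_scope.
Local Open Scope ring_scope.
Local Open Scope ereal_scope.

(** * Extended reals *)

Section ExtendedReals.
Context {R : realType}.
Implicit Types a b : \bar R.

Lemma lte_between_fin a b : a < b -> exists2 s : R, a < s%:E & s%:E < b.
Proof.
case: a b => [r| |] [r'| |] //; rewrite ?lte_fin.
- by move=> rr'; exists ((r + r') / 2)%R; rewrite lte_fin; lra.
- by move=> _; exists (r + 1)%R; rewrite ?ltry// lte_fin; lra.
- by move=> _; exists (r' - 1)%R; rewrite ?ltNyr// lte_fin; lra.
- by move=> _; exists 0%R; rewrite ?ltry ?ltNyr.
Qed.

Lemma lee_from_below a b :
  (forall s : R, s%:E < a -> s%:E <= b) -> a <= b.
Proof.
move=> ab; rewrite leNgt; apply/negP => /lte_between_fin[s bs /ab].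
by rewrite leNgt bs.
Qed.

Lemma le_inf_over {X : Type} (f : X -> \bar R) (S : set X) a :
  (forall x, S x -> a <= f x) -> a <= inf_over f S.
Proof. by move=> h; apply: le_ereal_inf_tmp => _ [x Sx <-]; exact: h. Qed.

Lemma inf_over_le {X : Type} (f : X -> \bar R) (S : set X) x :
  S x -> inf_over f S <= f x.
Proof. by move=> Sx; apply: ge_ereal_inf; exists (f x) => //; exists x. Qed.

End ExtendedReals.

(** * Upper and lower limits along a filter *)

Section LimitsAlongFilters.
Context {R : realType} {F : set_system R} {FF : ProperFilter F}.
Implicit Types (f g : R -> \bar R) (c : \bar R).

Lemma limf_esup_le f c :
  (\forall y \near F, f y <= c) -> limf_esup f F <= c.
Proof.
move=> fc; rewrite limf_esupE; apply: ge_ereal_inf.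
exists (ereal_sup [set f y | y in [set y | f y <= c]]).
  by exists [set y | f y <= c].
by apply: ge_ereal_sup => _ [y + <-].
Qed.

Lemma limf_esup_lt f c :
  limf_esup f F < c -> \forall y \near F, f y < c.
Proof.
rewrite limf_esupE => /ereal_inf_lt[_ [V FV <-] Vc].
apply: filterS FV => y Vy; apply: le_lt_trans Vc.
by apply: le_ereal_sup_tmp; exists (f y) => //; exists y.
Qed.

Lemma limf_einf_le f g :
  (\forall y \near F, f y <= g y) -> limf_einf f F <= limf_einf g F.
Proof.
move=> fg; rewrite !limf_einfE; apply: ge_ereal_sup => _ [V FV <-].
apply: le_ereal_sup_tmp.
exists (inf_over g (V `&` [set y | f y <= g y])).
  by exists (V `&` [set y | f y <= g y]) => //; exact: filterI.
apply: le_inf_over => y [Vy fgy]; exact: le_trans (inf_over_le f Vy) fgy.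
Qed.

Lemma limf_einf_le_esup f : limf_einf f F <= limf_esup f F.
Proof.
rewrite limf_einfE limf_esupE; apply: ge_ereal_sup => _ [V FV <-].
apply: le_ereal_inf_tmp => _ [W FW <-].
have [y [Vy Wy]] := filter_ex (filterI FV FW).
apply: le_trans (inf_over_le f Vy) _.
by apply: le_ereal_sup_tmp; exists (f y) => //; exists y.
Qed.

End LimitsAlongFilters.

(** * The tail of the exponential law *)

Section ExponentialTail.
Context {R : realType}.

Lemma exponential_prob_lt0 : exponential_prob 1 `]-oo, 0%R[ = 0 :> \bar R.
Proof.
rewrite /exponential_prob integral0_eq// => x /=; rewrite in_itv/= => x0.
by rewrite lt0_exponential_pdf.
Qed.

Lemma exponential_prob_gt (x : R) :
  (0 < x)%R -> exponential_prob 1 `]x, +oo[ = (expR (- x))%:E.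
Proof.
move=> x0.
have -> : `]x, +oo[%classic = ~` (`]-oo, 0%R[ `|` `[0%R, x]) :> set R.
  apply/seteqP; split=> z /=; rewrite !in_itv/= ?andbT.
    by move=> xz [|/andP[_]]; lra.
  move=> h; rewrite ltNge; apply/negP => zx; apply: h.
  by case: (ltP z 0%R); [left|right].
rewrite (probability_setC (exponential_prob (1 : R))); last exact: measurableU.
rewrite measureU//=; last first.
  by apply/seteqP; split=> z //=; rewrite !in_itv/= => -[z0 /andP[]]; lra.
have -> : exponential_prob 1 (`]-oo, 0%R[%classic : set R) = 0 :> \bar R.
  exact: exponential_prob_lt0.
rewrite add0e exponential_prob_itv0c// mulN1r.
by rewrite oppeB// addeA subee// add0e.
Qed.

End ExponentialTail.

(** * Topology of row vectors and of the orthant *)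

Section RowVectorTopology.
Context {R : realType} {m : nat}.
Implicit Types x z : 'rV[R]_m.

Lemma ball_rVP x z (e : R) : (0 < e)%R ->
  ball x e z <-> (forall j, `|x ord0 j - z ord0 j| < e)%R.
Proof.
move=> e0; split=> [[_ h] j|h]; first exact: h.
by split=> // i j; rewrite (ord1 i); exact: h.
Qed.

Lemma orthant_box_compact (a : R) :
  compact [set x : 'rV[R]_m | forall j, (0 <= x ord0 j <= a)%R].
Proof.
have -> : [set x : 'rV[R]_m | forall j, (0 <= x ord0 j <= a)%R] =
          [set x | forall j, `[0%R, a]%classic (x ord0 j)].
  by apply/seteqP; split=> x /= h j; move: (h j); rewrite in_itv.
apply: (@rV_compact _ _ (fun=> `[0%R, a]%classic)) => _.
exact: segment_compact.
Qed.

Lemma rV_rat_approx x (e : R) : (0 < e)%R ->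
  exists q : 'rV[rat]_m, forall j, (`|ratr (q ord0 j) - x ord0 j| < e)%R.
Proof.
move=> e0.
have /choice[q qP] : forall j, exists r : rat, (`|ratr r - x ord0 j| < e)%R.
  move=> j; have [|r] := @rat_in_itvoo R (x ord0 j) (x ord0 j + e)%R; first by lra.
  rewrite in_itv/= => /andP[xr rx]; exists r.
  by rewrite ger0_norm; lra.
by exists (\row_j q j)%R => j; rewrite mxE.
Qed.

(** Second countability in the explicit form needed below: the index type is
    countable, so it turns measurability of preimages of balls into
    measurability of preimages of open sets. *)
Lemma open_bigcup_rat_balls (U : set 'rV[R]_m) : open U ->
  U = \bigcup_(p : 'rV[rat]_m * nat)
        (if `[< ball (map_mx (@ratr R) p.1) p.2.+1%:R^-1 `<=` U >]
         then ball (map_mx (@ratr R) p.1) p.2.+1%:R^-1 else set0).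
Proof.
move=> oU; apply/seteqP; split=> [x Ux|x [p _]]; last first.
  by case: asboolP => // pU /pU.
have /nbhs_ballP[e /= e0 eU] := open_nbhs_nbhs (conj oU Ux).
(* the ball around q of radius 1/(n+1) contains x and has diameter below e *)
have [n _ /(_ n (leqnn n)) ne] :=
  near_infty_natSinv_lt (PosNum (divr_gt0 e0 (ltr0n R 2))).
have n0 : (0 < n.+1%:R^-1 :> R)%R by rewrite invr_gt0.
have [q qx] := rV_rat_approx x n0.
have xq : ball (map_mx (@ratr R) q) n.+1%:R^-1 x.
  by apply/ball_rVP => // j; rewrite mxE.
exists (q, n) => //=; case: asboolP => // -[] z qz; apply: eU.
have := ball_triangle (ball_sym xq) qz; apply: le_ball.
have {}ne : (n.+1%:R^-1 < e / 2)%R by [].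
by rewrite [leRHS]splitr lerD // ltW.
Qed.

Lemma orthant_closure_sup (A : set 'rV[R]_m) :
  A `<=` orthant -> closure A `&` orthant `<=` orthant_closure A.
Proof.
move=> Ao x [cAx ox] B.
have -> : nbhs (x : subspace orthant) B = nbhs x [set y | orthant y -> B y].
  by rewrite -[LHS]/(nbhs_subspace x B) -nbhs_subspace_in.
by move=> /cAx[y [Ay /(_ (Ao _ Ay))]]; exists y.
Qed.

Lemma orthant_interior_ball (A : set 'rV[R]_m) x :
  A `<=` orthant -> orthant_interior A x ->
  exists2 e : R, (0 < e)%R & ball x e `&` orthant `<=` A.
Proof.
move=> Ao iAx; have ox : orthant x by apply: Ao; exact: interior_subset iAx.
have : nbhs x [set y | orthant y -> A y].
  have := iAx; rewrite /orthant_interior /interior.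
  by rewrite -[X in X -> _]/(nbhs_subspace x A) -nbhs_subspace_in.
by move=> /nbhs_ballP[e e0 eA]; exists e => // z [/eA].
Qed.

End RowVectorTopology.

(** * Measurability of random vectors *)

Section BorelPreimages.
Context {d : measure_display} {T : measurableType d} {R : realType} {m : nat}.
Variable f : T -> 'rV[R]_m.
Hypothesis f_meas : forall j, measurable_fun setT (fun w => f w ord0 j).

Lemma measurable_preimage_ball x (e : R) : measurable (f @^-1` ball x e).
Proof.
have [e0|e0] := ltP 0%R e; last first.
  rewrite (_ : _ @^-1` _ = set0)//; apply/seteqP; split=> // w [e1 _].
  by move: e1; rewrite ltNge e0.
rewrite (_ : _ @^-1` _ =
    \bigcap_(j in [set: 'I_m]) ((fun w => f w ord0 j) @^-1` ball (x ord0 j) e)).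
  apply: fin_bigcap_measurable => // j _.
  rewrite -[X in measurable X]setTI; apply: f_meas => //.
  exact: measurable_ball.
apply/seteqP; split=> w /=; first by move=> /(ball_rVP _ _ e0) h j _; exact: h.
by move=> h; apply/(ball_rVP _ _ e0) => j; exact: h.
Qed.

Lemma measurable_preimage_borel (B : set 'rV[R]_m) :
  borel B -> measurable (f @^-1` B).
Proof.
suff : borel `<=` [set B | measurable (f @^-1` B)] by apply.
apply: smallest_sub.
  split=> /= [|A mA|A mA].
  - by rewrite preimage_set0.
  - by rewrite setTD preimage_setC; exact: measurableC.
  - by rewrite preimage_bigcup; exact: bigcup_measurable.
move=> U oU /=; rewrite (open_bigcup_rat_balls oU) preimage_bigcup.
apply: countable_bigcupT_measurable => [|p]; first exact: countableP.
case: ifPn => _.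
  exact: measurable_preimage_ball.
by rewrite preimage_set0.
Qed.

End BorelPreimages.

(** * Sets decaying at an exponential rate *)

Section ExponentialDecay.
Context {d : measure_display} {T : measurableType d} {R : realType}.
Context {P : probability T R} {m : nat}.
Variable Y : 'I_m -> {RV P >-> R}.
Implicit Types (A S : set 'rV[R]_m) (s t y : R).

Definition rescaled y (w : T) : 'rV[R]_m := (y^-1 *: \row_j Y j w)%R.

(** The outer measure makes [outer_prob] monotone and subadditive on all sets,
    so that covering arguments need no measurability hypothesis; on Borel sets
    it is the probability that the rescaled vector lies in [S]
    ([outer_prob_borel]). *)
Definition outer_prob S y : \bar R := P^*%mu (rescaled y @^-1` S).

Definition decays s S :=
  exists2 C : R, (0 < C)%R &
    \forall y \near +oo%R, outer_prob S y <= (C * expR (- (s * y)))%:E.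

Lemma le_outer_prob S S' y : S `<=` S' -> outer_prob S y <= outer_prob S' y.
Proof. by move=> SS'; apply: le_mu_ext => w; exact: SS'. Qed.

Lemma outer_probU S S' y :
  outer_prob (S `|` S') y <= outer_prob S y + outer_prob S' y.
Proof. by rewrite /outer_prob preimage_setU; exact: outer_measureU2. Qed.

Lemma measurable_rescaled S y : borel S -> measurable (rescaled y @^-1` S).
Proof.
apply: measurable_preimage_borel => j.
rewrite (_ : (fun w => _) = (fun w => y^-1 * Y j w)%R); last first.
  by apply/funext => w; rewrite /rescaled !mxE.
exact: measurable_funM.
Qed.

Lemma outer_prob_borel S y :
  borel S -> outer_prob S y = P (rescaled y @^-1` S).
Proof. by move=> bS; apply: measurable_mu_extE; exact: measurable_rescaled. Qed.

Lemma outer_prob_setT y : outer_prob setT y = 1.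
Proof.
rewrite /outer_prob preimage_setT measurable_mu_extE//.
exact: probability_setT.
Qed.

Lemma outer_prob_le1 S y : outer_prob S y <= 1.
Proof. by rewrite -(outer_prob_setT y); exact: le_outer_prob. Qed.

Lemma decays_le s S S' : S `<=` S' -> decays s S' -> decays s S.
Proof.
move=> SS' [C C0 CS']; exists C => //.
apply: filterS CS' => y; apply: le_trans; exact: le_outer_prob.
Qed.

Lemma decays_weaken s t S : (s <= t)%R -> decays t S -> decays s S.
Proof.
move=> st [C C0 CS]; exists C => //.
near=> y; have y0 : (0 < y)%R by [].
apply: (@le_trans _ _ (C * expR (- (t * y)))%:E); first by near: y.
by rewrite lee_fin ler_pM2l// ler_expR lerN2 ler_pM2r.
Unshelve. all: by end_near. Qed.

Lemma decays_nonpos s S : (s <= 0)%R -> decays s S.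
Proof.
move=> s0; apply: (decays_weaken s0); exists 1%R => //.
by near=> y; rewrite mul0r oppr0 expR0 mul1r; exact: outer_prob_le1.
Unshelve. all: by end_near. Qed.

Lemma decays_set0 s : decays s set0.
Proof.
exists 1%R => //; near=> y.
rewrite /outer_prob preimage_set0 measurable_mu_extE// measure0 lee_fin.
by rewrite mul1r expR_ge0.
Unshelve. all: by end_near. Qed.

Lemma decaysU s S S' : decays s S -> decays s S' -> decays s (S `|` S').
Proof.
move=> [C C0 CS] [C' C'0 CS']; exists (C + C')%R; first exact: addr_gt0.
near=> y; apply: le_trans (outer_probU S S' y) _.
by rewrite mulrDl EFinD leeD//; near: y.
Unshelve. all: by end_near. Qed.

Lemma decays_bigcup_finite {K : choiceType} s (D : set K)
    (F : K -> set 'rV[R]_m) : finite_set D ->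
  (forall i, D i -> decays s (F i)) -> decays s (\bigcup_(i in D) F i).
Proof.
move=> /finite_seqP[r ->] h; rewrite bigcup_seq big_seq.
by apply: big_ind => [|S S'|]; [exact: decays_set0|exact: decaysU|exact: h].
Qed.

(** Since [(l * y)^-1 *: Y = l^-1 *: (y^-1 *: Y)], the bound for [S] at time
    [l * y] is a bound for the dilation of [S] by [l] at time [y]. *)
Lemma decays_scale (l : R) s S : (0 < l)%R ->
  decays s S -> decays (l * s)%R [set x | S (l^-1 *: x)%R].
Proof.
move=> l0 [C C0 CS]; exists C => //.
have cvl : (l * y)%R @[y --> +oo%R] --> +oo%R by apply: gt0_cvgMry.
have CSl : \forall y \near +oo%R,
  outer_prob S (l * y)%R <= (C * expR (- (s * (l * y))))%:E by exact: (cvl _ CS).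
apply: filterS CSl => y; rewrite mulrA [(s * l)%R]mulrC.
congr (P^*%mu _ <= _); apply/funext => w.
by rewrite /preimage/= /rescaled scalerA invfM.
Qed.

(** If [s > t], then [exp (- t * y) <= C * exp (- s * y)] fails as soon as
    [exp ((s - t) * y) > C]. *)
Lemma decays_rate_le s t S :
  (\forall y \near +oo%R, (expR (- (t * y)))%:E <= outer_prob S y) ->
  decays s S -> (s <= t)%R.
Proof.
move=> tS [C C0 CS]; rewrite leNgt; apply/negP => ts.
near (+oo%R : set_system R) => y.
have : ((expR (- (t * y)))%:E <= (C * expR (- (s * y)))%:E :> \bar R)%E.
  apply: (@le_trans _ _ (outer_prob S y)); near: y; [exact: tS|exact: CS].
rewrite lee_fin leNgt => /negP; apply.
have -> : (- (s * y) = - ((s - t) * y) + - (t * y))%R by ring.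
rewrite expRD mulrA gtr_pMl ?expR_gt0//.
rewrite expRN ltr_pdivrMr ?expR_gt0// mul1r.
apply: lt_le_trans (expR_ge1Dx _).
have : (C / (s - t) < y)%R by near: y; apply: nbhs_pinfty_gt; rewrite num_real.
rewrite ltr_pdivrMr ?subr_gt0//; lra.
Unshelve. all: by end_near. Qed.

(** The constant contributes [ln C / y], which tends to 0. *)
Lemma limsup_le_decays s S : borel S -> decays s S ->
  limsup_log_prob Y S <= (- s)%:E.
Proof.
move=> bS [C C0 CS]; apply/lee_addgt0Pr => e e0.
apply: limf_esup_le; near=> y.
have y0 : (0 < y)%R by [].
rewrite /scaled_log_prob lee_pdivrMl//.
have pS : P (rescaled y @^-1` S) <= (C * expR (- (s * y)))%:E.
  by rewrite -outer_prob_borel//; near: y.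
apply: (@le_trans _ _ (lne (C * expR (- (s * y)))%:E)).
  rewrite lee_lne//; rewrite in_itv/= leey andbT ?measure_ge0//.
  by rewrite lee_fin mulr_ge0 ?expR_ge0 ?ltW.
rewrite lne_EFin ?mulr_gt0 ?expR_gt0// lnM ?posrE ?expR_gt0// expRK.
rewrite -EFinD -EFinM lee_fin.
have : (ln C / e < y)%R by near: y; apply: nbhs_pinfty_gt; rewrite num_real.
rewrite ltr_pdivrMr//; lra.
Unshelve. all: by end_near. Qed.

(** The strict inequality makes the bound hold eventually with constant 1. *)
Lemma decays_limsup_lt s S : borel S ->
  limsup_log_prob Y S < (- s)%:E -> decays s S.
Proof.
move=> bS /limf_esup_lt h; exists 1%R => //; near=> y.
have y0 : (0 < y)%R by [].
have : scaled_log_prob Y S y < (- s)%:E by near: y; exact: h.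
rewrite /scaled_log_prob lte_pdivrMl// => /ltW.
rewrite -[X in lne X]/(P (rescaled y @^-1` S)) => pS.
rewrite outer_prob_borel// mul1r -[leLHS]lneK; last first.
  by rewrite in_itv/= measure_ge0 leey.
by rewrite -[leRHS]/(expeR (- (s * y))%:E) lee_expeR mulrC -mulrN.
Unshelve. all: by end_near. Qed.

End ExponentialDecay.

(** * The local rate function *)

Section LocalRates.
Context {d : measure_display} {T : measurableType d} {R : realType}.
Context {P : probability T R} {m : nat}.
Variable Y : 'I_m -> {RV P >-> R}.
Implicit Types (x : 'rV[R]_m) (s e : R).

Lemma borel_ball x e : borel (ball x e).
Proof. by apply: sub_gen_smallest; exact: ball_open. Qed.

Lemma upper_local_rate_ge s e x : (0 < e)%R ->
  decays Y s (ball x e) -> s%:E <= upper_local_rate Y x.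
Proof.
move=> e0 dxe; rewrite /upper_local_rate leeNr; apply: ge_ereal_inf.
exists (limsup_log_prob Y (ball x e)); first by exists e.
exact: limsup_le_decays (borel_ball x e) dxe.
Qed.

Lemma upper_local_rate_gt s x : s%:E < upper_local_rate Y x ->
  exists2 e, (0 < e)%R & decays Y s (ball x e).
Proof.
rewrite /upper_local_rate lteNr => /ereal_inf_lt[_ [e /= e0 <-] xe].
by exists e => //; apply: decays_limsup_lt xe; exact: borel_ball.
Qed.

Lemma decays_compact s (K : set 'rV[R]_m) : compact K ->
  (forall x, K x -> exists2 e, (0 < e)%R & decays Y s (ball x e)) ->
  decays Y s K.
Proof.
move=> cK /= ballK.
have /choice[e eP] x : exists e, K x -> (0 < e)%R /\ decays Y s (ball x e).
  have [/ballK[e e0 dxe]|nKx] := pselect (K x); last by exists 0%R.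
  by exists e.
move: cK; rewrite compact_cover => /(_ _ K (fun x => ball x (e x)))[||D DK KD].
- by move=> x _; exact: ball_open.
- by move=> x Kx; exists x => //; apply: ballxx; have [] := eP x Kx.
apply: decays_le KD _; apply: decays_bigcup_finite => [|x /= xD].
  exact: finite_fset.
by have /set_mem/eP[] := DK x xD.
Qed.

Lemma upper_local_rate_ge0 x : 0 <= upper_local_rate Y x.
Proof. by apply: (@upper_local_rate_ge _ 1%R) => //; exact: decays_nonpos. Qed.

(** A ball around [x] that decays at rate [s] contains a ball around each of its
    points, so the rate is at least [s] throughout it. *)
Lemma upper_local_rate_lsc : lower_semicontinuous (upper_local_rate Y).
Proof.
move=> x a /lte_between_fin[s as_ /upper_local_rate_gt[e e0 dxe]].
exists (ball x e) => [|z xez]; first exact: nbhsx_ballx.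
have /nbhs_ballP[r r0 zr] := open_nbhs_nbhs (conj (ball_open x e) xez).
apply: lt_le_trans as_ _; apply: (upper_local_rate_ge r0).
exact: decays_le dxe.
Qed.

(** Dilating a ball around [x] by [l] gives a ball around [l *: x], so the rates
    of decay scale by [l]. *)
Lemma upper_local_rate_scale_ge (l : R) x : (0 < l)%R ->
  l%:E * upper_local_rate Y x <= upper_local_rate Y (l *: x)%R.
Proof.
move=> l0; rewrite -lee_pdivlMl//; apply: lee_from_below => s.
move=> /upper_local_rate_gt[e e0 dxe].
rewrite lee_pdivlMl// -EFinM.
apply: (@upper_local_rate_ge _ (l * e)%R); first exact: mulr_gt0.
apply: (decays_le _ (decays_scale l0 dxe)) => z /=.
move=> /(ball_rVP _ _ (mulr_gt0 l0 e0)) h.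
apply/ball_rVP => // j; have := h j; rewrite !mxE.
rewrite (_ : (l * x ord0 j - z ord0 j = l * (x ord0 j - l^-1 * z ord0 j))%R).
  by rewrite normrM gtr0_norm// ltr_pM2l.
by rewrite mulrBr mulrA divff ?mul1r// gt_eqF.
Qed.

(** The reverse inequality is [upper_local_rate_scale_ge] for [l^-1] at
    [l *: x]. *)
Lemma upper_local_rate_scale (l : R) x : (0 < l)%R ->
  upper_local_rate Y (l *: x)%R = l%:E * upper_local_rate Y x.
Proof.
move=> l0; apply/eqP; rewrite eq_le upper_local_rate_scale_ge// andbT.
rewrite -lee_pdivrMl// -[in leRHS](scale1r x) -(mulVf (lt0r_neq0 l0)) -scalerA.
by apply: upper_local_rate_scale_ge; rewrite invr_gt0.
Qed.

End LocalRates.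

(** * Exponential marginals *)

Section ExponentialMarginals.
Context {d : measure_display} {T : measurableType d} {R : realType}.
Context {P : probability T R} {m : nat}.
Variable Y : 'I_m -> {RV P >-> R}.
Hypothesis Y_exp : forall j, standard_exponential (Y j).
Implicit Types (A : set 'rV[R]_m) (x : 'rV[R]_m) (s t y : R).

Lemma outer_prob_coord j (B : set R) y : measurable B -> (0 < y)%R ->
  outer_prob Y [set x | B (y * x ord0 j)%R] y = exponential_prob 1 B.
Proof.
move=> mB y0; rewrite -(Y_exp j mB) /outer_prob.
rewrite (_ : _ @^-1` _ = Y j @^-1` B).
  by rewrite measurable_mu_extE//; exact: measurable_funPTI.
by apply/funext => w; rewrite /preimage/= !mxE mulrA divff ?mul1r// gt_eqF.
Qed.

Lemma outer_prob_coord_lt0 j y : (0 < y)%R ->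
  outer_prob Y [set x | (x ord0 j < 0)%R] y = 0.
Proof.
move=> y0; rewrite -exponential_prob_lt0 -(outer_prob_coord j _ y0)//.
congr (outer_prob _ _ _); apply/funext => x.
by rewrite /= in_itv/= pmulr_rlt0.
Qed.

Lemma outer_prob_coord_gt j t y : (0 < t)%R -> (0 < y)%R ->
  outer_prob Y [set x | (t < x ord0 j)%R] y = (expR (- (t * y)))%:E.
Proof.
move=> t0 y0; rewrite mulrC -exponential_prob_gt ?mulr_gt0//.
rewrite -(outer_prob_coord j _ y0)//.
congr (outer_prob _ _ _); apply/funext => x.
by rewrite /= in_itv/= andbT ltr_pM2l.
Qed.

Lemma decays_coord_lt0 j s : decays Y s [set x | (x ord0 j < 0)%R].
Proof.
by exists 1%R => //; near=> y; rewrite outer_prob_coord_lt0.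
Unshelve. all: by end_near. Qed.

Lemma decays_coord_gt j s t : (s <= t)%R ->
  decays Y s [set x | (t < x ord0 j)%R].
Proof.
move=> st; have [t0|t0] := leP t 0%R; first by apply: decays_nonpos; lra.
apply: (decays_weaken st); exists 1%R => //; near=> y.
by rewrite mul1r outer_prob_coord_gt.
Unshelve. all: by end_near. Qed.

Lemma setC_orthant :
  ~` orthant = \bigcup_j [set x : 'rV[R]_m | (x ord0 j < 0)%R].
Proof.
apply/seteqP; split=> [x /existsNP[j /negP]|x [j _ /= xj] /(_ j)].
  by rewrite -ltNge => xj; exists j.
by rewrite leNgt xj.
Qed.

Lemma decays_setC_orthant s : decays Y s (~` orthant).
Proof.
rewrite setC_orthant.
apply: decays_bigcup_finite => [|j _]; first exact: finite_finset.
exact: decays_coord_lt0.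
Qed.

(** The complement of the orthant is a finite union of null half-spaces. *)
Lemma outer_prob_orthant A y : (0 < y)%R ->
  outer_prob Y A y <= outer_prob Y (A `&` orthant) y.
Proof.
move=> y0; have null : outer_prob Y (~` orthant) y <= 0.
  rewrite setC_orthant.
  have /finite_seqP[r ->] : finite_set [set: 'I_m] by exact: finite_finset.
  rewrite bigcup_seq; elim/big_ind : _ => [|S S' S0 S'0|j _].
  - by rewrite /outer_prob preimage_set0 mu_ext0.
  - by apply: le_trans (outer_probU _ _ _ _) _; rewrite -[leRHS]adde0 leeD.
  - by rewrite outer_prob_coord_lt0.
rewrite -[leRHS]adde0; apply: le_trans (leeD (lexx _) null).
apply: le_trans (outer_probU _ _ _ _).
apply: le_outer_prob => x Ax.
by have [?|?] := pselect (orthant x); [left|right].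
Qed.

(** A small enough ball around [x] lies in the tail [{z | z_j > t}]. *)
Lemma upper_local_rate_ge_coord x j t :
  (t < x ord0 j)%R -> t%:E <= upper_local_rate Y x.
Proof.
move=> tx; apply: (upper_local_rate_ge (e := (x ord0 j - t)%R)); first by lra.
apply: (decays_le _ (decays_coord_gt j (lexx t))) => z /ball_rVP/= h.
have /h/(_ j) : (0 < x ord0 j - t)%R by lra.
by rewrite ltr_norml; lra.
Qed.

(** A small enough ball around [x] lies in a negative half-space, which has
    outer probability 0 and so decays at every rate. *)
Lemma upper_local_rate_out x : ~ orthant x -> upper_local_rate Y x = +oo.
Proof.
rewrite -[~ _]/((~` orthant) x) setC_orthant => -[j _ /= xj].
apply/eqP; rewrite -leye_eq; apply: lee_from_below => s _.
apply: (upper_local_rate_ge (e := (- x ord0 j)%R)); first by lra.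
apply: (decays_le _ (decays_coord_lt0 j s)) => z /ball_rVP/= h.
have /h/(_ j) : (0 < - x ord0 j)%R by lra.
by rewrite ltr_norml; lra.
Qed.

(** Sublevel sets are closed by lower semicontinuity and lie in the box
    [[0, a]^m]: the rate is infinite off the orthant and at least [t] wherever
    some coordinate exceeds [t]. *)
Lemma upper_local_rate_sublevel_compact (a : R) :
  compact (upper_local_rate Y @^-1` `[0, a%:E]).
Proof.
apply: (subclosed_compact _ (@orthant_box_compact R m a)).
  rewrite (_ : _ @^-1` _ = ~` [set x | a%:E < upper_local_rate Y x]).
    apply: open_closedC.
    by have /lower_semicontinuousP/(_ a) := @upper_local_rate_lsc _ _ _ _ _ Y.
  apply/seteqP; split=> x /=; rewrite in_itv/= upper_local_rate_ge0/=.
    by rewrite leNgt => /negP.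
  by rewrite leNgt => /negP.
move=> x /=; rewrite in_itv/= upper_local_rate_ge0/= => xa j.
have -> /= : (0 <= x ord0 j)%R.
  have [/(_ j)//|/upper_local_rate_out xoo] := pselect (orthant x).
  by move: xa; rewrite xoo.
rewrite leNgt; apply/negP => ax.
(* the midpoint of a and x_j lies strictly below x_j and above a *)
have : (((a + x ord0 j) / 2)%:E <= a%:E :> \bar R)%E.
  by apply: le_trans xa; apply: (@upper_local_rate_ge_coord _ j); lra.
by rewrite lee_fin; lra.
Qed.

(** The upper bound.  Points of [A] with a coordinate above [s] are handled by
    the tails, so local decay is needed only on a compact set. *)
Lemma decays_of_rate_gt s A :
  (forall x, closure A x -> orthant x -> s%:E < upper_local_rate Y x) ->
  decays Y s A.
Proof.
move=> sA; pose K := closure A `&` [set x | forall j, (0 <= x ord0 j <= s)%R].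
have Kcompact : compact K.
  apply: (subclosed_compact _ (@orthant_box_compact R m s)); last by move=> x [].
  apply: closedI; first exact: closed_closure.
  apply: compact_closed; last exact: orthant_box_compact.
  exact: norm_hausdorff.
have dK : decays Y s K.
  apply: decays_compact Kcompact _ => x [cAx xs].
  by apply/upper_local_rate_gt/sA => // j; case/andP: (xs j).
have dfar : decays Y s (\bigcup_j [set x | (s < x ord0 j)%R]).
  apply: decays_bigcup_finite => [|j _]; first exact: finite_finset.
  exact: decays_coord_gt.
apply: (decays_le _ (decaysU (decays_setC_orthant s) (decaysU dfar dK))) => x Ax.
have [ox|nox] := pselect (orthant x); last by left.
right; have [[j sx]|/forallNP xs] := pselect (exists j, (s < x ord0 j)%R).
  by left; exists j.
right; split; first exact: subset_closure.
by move=> j; rewrite ox/= leNgt; apply/negP/xs.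
Qed.

(** If the rate at 0 were positive, a ball around 0 would decay at a positive
    rate; so would its complement in the orthant, by the tails, hence the whole
    space, whose probability is 1. *)
Lemma upper_local_rate0 : upper_local_rate Y 0%R = 0.
Proof.
apply/eqP; rewrite eq_le upper_local_rate_ge0 andbT leNgt; apply/negP.
move=> /lte_between_fin[s s0 /upper_local_rate_gt[e e0 d0e]].
rewrite lte_fin in s0.
pose t := Num.min s (e / 2)%R.
have t0 : (0 < t)%R by rewrite lt_min s0 divr_gt0.
have far : decays Y t (\bigcup_j [set x | (e / 2 < x ord0 j)%R]).
  apply: decays_bigcup_finite => [|j _]; first exact: finite_finset.
  by apply: decays_coord_gt; rewrite ge_min lexx orbT.
have near0 : decays Y t (ball 0%R e).
  by apply: decays_weaken d0e; rewrite ge_min lexx.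
suff dT : decays Y t setT.
  suff : (t <= 0)%R by rewrite leNgt t0.
  apply: decays_rate_le dT; near=> y.
  by rewrite mul0r oppr0 expR0 outer_prob_setT.
apply: (decays_le _ (decaysU (decays_setC_orthant t) (decaysU far near0))) => x _.
have [ox|nox] := pselect (orthant x); last by left.
right; have [[j xj]|/forallNP xe] := pselect (exists j, (e / 2 < x ord0 j)%R).
  by left; exists j.
right; apply/ball_rVP => // j; rewrite mxE sub0r normrN ger0_norm//.
by have /negP := xe j; rewrite -leNgt; lra.
Unshelve. all: by end_near. Qed.

(** If the infimum exceeded some [s > l], then, with [t] strictly between [l]
    and [s], the rate would exceed [s] on the closure of [{x | x_j > t}].  That
    tail would then decay at rate [s], faster than its probability
    [exp (- t * y)]. *)
Lemma inf_upper_local_rate_coord_gt (l : R) j : (0 <= l)%R ->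
  inf_over (upper_local_rate Y) [set x | (l < x ord0 j)%R] = l%:E.
Proof.
move=> l0; apply/eqP; rewrite eq_le; apply/andP; split; last first.
  by apply: le_inf_over => x; exact: upper_local_rate_ge_coord.
rewrite leNgt; apply/negP => /lte_between_fin[s ls slt].
rewrite lte_fin in ls.
pose t := ((l + s) / 2)%R.
suff : decays Y s [set x | (t < x ord0 j)%R].
  move=> /(@decays_rate_le _ _ _ _ _ _ s t) st.
  have : (s <= t)%R.
    apply: st; near=> y; rewrite outer_prob_coord_gt// /t; lra.
  by rewrite /t; lra.
apply: decays_of_rate_gt => x cx _.
apply: lt_le_trans slt (inf_over_le _ _) => /=.
suff : (t <= x ord0 j)%R by rewrite /t; lra.
rewrite leNgt; apply/negP => xt.
have d0 : (0 < t - x ord0 j)%R by lra.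
have [z [/= tz /(ball_rVP _ _ d0)/(_ j)]] := cx _ (nbhsx_ballx x _ d0).
by rewrite ltr_norml; lra.
Unshelve. all: by end_near. Qed.

(** The lower bound: some ball around [x] meets the orthant inside [A]. *)
Lemma lower_local_rate_interior A x :
  borel A -> A `<=` orthant -> orthant_interior A x ->
  - lower_local_rate Y x <= liminf_log_prob Y A.
Proof.
move=> bA Ao /(orthant_interior_ball Ao)[e e0 eA].
rewrite /lower_local_rate oppeK; apply: ge_ereal_inf.
exists (liminf_log_prob Y (ball x e)); first by exists e.
apply: limf_einf_le; near=> y.
have y0 : (0 < y)%R by [].
rewrite /scaled_log_prob lee_pmul2l ?lte_fin ?invr_gt0//.
rewrite lee_lne ?in_itv/= ?measure_ge0 ?leey//.
have -> : P [set w | ball x e (y^-1 *: \row_j Y j w)%R] =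
          outer_prob Y (ball x e) y.
  by rewrite outer_prob_borel//; exact: borel_ball.
have -> : P [set w | A (y^-1 *: \row_j Y j w)%R] = outer_prob Y A y.
  by rewrite outer_prob_borel.
apply: le_trans (outer_prob_orthant _ y0) _; exact: le_outer_prob.
Unshelve. all: by end_near. Qed.

Lemma limsup_le_inf_closure A : borel A -> A `<=` orthant ->
  limsup_log_prob Y A <= - inf_over (upper_local_rate Y) (orthant_closure A).
Proof.
move=> bA Ao; rewrite leeNr; apply: lee_from_below => s sI.
rewrite leeNr; apply: limsup_le_decays bA _.
apply: decays_of_rate_gt => x cx ox.
apply: lt_le_trans sI (inf_over_le _ _).
exact: orthant_closure_sup.
Qed.

End ExponentialMarginals.

Theorem theorem1 (d : measure_display) (T : measurableType d) (R : realType)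
  (P : probability T R) (m : nat) (Y : 'I_m -> {RV P >-> R})
  (Y_exp : forall j, standard_exponential (Y j))
  (I : 'rV[R]_m -> \bar R)
  (I_lower : forall x, I x = lower_local_rate Y x)
  (I_upper : forall x, I x = upper_local_rate Y x) :
  [/\ forall A : set 'rV[R]_m, borel A -> A `<=` orthant ->
        [/\ - inf_over I (orthant_interior A) <= liminf_log_prob Y A,
            liminf_log_prob Y A <= limsup_log_prob Y A
          & limsup_log_prob Y A <= - inf_over I (orthant_closure A)],
      good_rate_function I,
      forall (l : R) (x : 'rV[R]_m), (0 < l)%R -> I (l *: x)%R = l%:E * I x,
      I 0%R = 0
    & forall (l : R) (j : 'I_m), (0 <= l)%R ->
        inf_over I [set x : 'rV[R]_m | (l < x ord0 j)%R] = l%:E].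
Proof.
have -> : I = upper_local_rate Y by apply/funext.
split.
- move=> A bA Ao; split; last exact: limsup_le_inf_closure.
  + rewrite leeNl; apply: le_inf_over => x ix.
    rewrite -I_upper I_lower leeNl; exact: lower_local_rate_interior.
  + exact: limf_einf_le_esup.
- split; first by split; [exact: upper_local_rate_ge0|exact: upper_local_rate_lsc].
  by move=> a _; exact: upper_local_rate_sublevel_compact.
- by move=> l x; exact: upper_local_rate_scale.
- exact: upper_local_rate0.
- by move=> l j; exact: inf_upper_local_rate_coord_gt.
Qed.
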